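(* Let $\mathcal A$ be an artinian category. Then cover-equivalence is an equivalence relation on graded covers of $\mathcal A$, i.e. it is reflexive, symmetric and transitive.
   Context: An artinian category is an abelian category in which each object has finite length. A graded cover of an artinian category $\mathcal A$ is a triple $(\tilde{\mathcal A},v,\epsilon)$ consisting of an abelian category $\tilde{\mathcal A}$ equipped with a strict automorphism $[1]$ (with $i$-th power $[i]$, $i\in\mathbb Z$), an exact functor $v:\tilde{\mathcal A}\to\mathcal A$ and a natural isomorphism $\epsilon:v\Rightarrow v[1]$, such that: (1) for all $M,N\in\tilde{\mathcal A}$ the pair $(v,\epsilon)$ induces an isomorphism $\bigoplus_{i\in\mathbb Z}\tilde{\mathcal A}(M,N[i])\to\mathcal A(vM,vN)$ (apply $v$ and identify $v(N[i])$ with $vN$ via iterates of $\epsilon^{\pm1}$); (2) given $M\in\mathcal A$, $N\in\tilde{\mathcal A}$ and an epimorphism $M\twoheadrightarrow vN$, there exist $P\in\tilde{\mathcal A}$ and an epimorphism $vP\twoheadrightarrow M$ such that the composition $vP\to vN$ comes (via $v$) from a morphism $P\to N$ in $\tilde{\mathcal A}$. Cover-equivalence: let $(\tilde{\mathcal A},\tilde v,\tilde\epsilon)$ and $(\hat{\mathcal A},\hat v,\hat\epsilon)$ be graded covers of $\mathcal A$. A cover-equivalence from the first to the second is a triple $(F,\pi,\epsilon)$ with $F:\tilde{\mathcal A}\to\hat{\mathcal A}$ an additive functor and $\epsilon:[1]F\Rightarrow F[1]$, $\pi:\hat vF\Rightarrow\tilde v$ natural isomorphisms such that the two natural isomorphisms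 $\hat vF\overset{\hat\epsilon}{\Rightarrow}\hat v[1]F\overset{\epsilon}{\Rightarrow}\hat vF[1]\overset{\pi}{\Rightarrow}\tilde v[1]$ and $\hat vF\overset{\pi}{\Rightarrow}\tilde v\overset{\tilde\epsilon}{\Rightarrow}\tilde v[1]$ coincide. The first graded cover is said to be cover-equivalent to the second if there exists a cover-equivalence from the first to the second. *)

(* Defs.v *)
From mathcomp Require Import all_boot all_order all_algebra.
From mathcomp Require Import boolp classical_sets functions cardinality fsbigop.

Set Implicit Arguments.
Unset Strict Implicit.
Unset Printing Implicit Defensive.

Import GRing.Theory.
Local Open Scope ring_scope.

(** * Preadditive categories *)

(* The morphisms between two objects form an abelian group, and composition is
   biadditive.  Equality of objects and of morphisms is Leibniz equality. *)
Record preadditive := Preadditive {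
  obj :> Type;
  hom : obj -> obj -> zmodType;
  idm : forall X, hom X X;
  comp : forall X Y Z, hom Y Z -> hom X Y -> hom X Z;
  comp1m : forall X Y (f : hom X Y), comp (idm Y) f = f;
  compm1 : forall X Y (f : hom X Y), comp f (idm X) = f;
  compA : forall W X Y Z (h : hom Y Z) (g : hom X Y) (f : hom W X),
    comp h (comp g f) = comp (comp h g) f;
  compDl : forall X Y Z (g g' : hom Y Z) (f : hom X Y),
    comp (g + g') f = comp g f + comp g' f;
  compDr : forall X Y Z (g : hom Y Z) (f f' : hom X Y),
    comp g (f + f') = comp g f + comp g f' }.

Arguments hom {p} X Y.
Arguments idm {p} X.
Arguments comp {p X Y Z} g f.

Notation "g ∘ f" := (comp g f) (at level 40, left associativity).

Definition eq_hom (C : preadditive) (X Y : C) (e : X = Y) : hom X Y :=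
  match e in _ = Y' return hom X Y' with erefl => idm X end.

Section Morphisms.
Variable C : preadditive.
Implicit Types X Y Z W K Q : C.

Definition mono X Y (f : hom X Y) : Prop :=
  forall W (g h : hom W X), f ∘ g = f ∘ h -> g = h.

Definition epi X Y (f : hom X Y) : Prop :=
  forall W (g h : hom Y W), g ∘ f = h ∘ f -> g = h.

Definition is_iso X Y (f : hom X Y) : Prop :=
  exists g : hom Y X, g ∘ f = idm X /\ f ∘ g = idm Y.

Definition is_zero Z : Prop :=
  forall X, (exists! f : hom X Z, True) /\ (exists! f : hom Z X, True).

Definition is_biproduct X Y B
    (i1 : hom X B) (i2 : hom Y B) (p1 : hom B X) (p2 : hom B Y) : Prop :=
  [/\ p1 ∘ i1 = idm X, p2 ∘ i2 = idm Y, p1 ∘ i2 = 0, p2 ∘ i1 = 0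
    & i1 ∘ p1 + i2 ∘ p2 = idm B].

Definition is_kernel X Y (f : hom X Y) K (k : hom K X) : Prop :=
  f ∘ k = 0 /\
  forall W (g : hom W X), f ∘ g = 0 -> exists! h : hom W K, k ∘ h = g.

Definition is_cokernel X Y (f : hom X Y) Q (q : hom Y Q) : Prop :=
  q ∘ f = 0 /\
  forall W (g : hom Y W), g ∘ f = 0 -> exists! h : hom Q W, h ∘ q = g.

Definition short_exact X Y Z (f : hom X Y) (g : hom Y Z) : Prop :=
  is_kernel g f /\ is_cokernel f g.

Definition simple Z : Prop :=
  ~ is_zero Z /\
  forall X (f : hom X Z), mono f -> is_zero X \/ is_iso f.

(* A derivation is a composition series 0 = X_0 ⊂ X_1 ⊂ ... ⊂ X_n = X with
   simple subquotients, listed from the bottom. *)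
Inductive finite_length : C -> Prop :=
| finite_length0 X : is_zero X -> finite_length X
| finite_lengthS X Y S (f : hom X Y) (g : hom Y S) :
    short_exact f g -> simple S -> finite_length X -> finite_length Y.

End Morphisms.

Record is_abelian (C : preadditive) : Prop := IsAbelian {
  abelian_zero : exists Z : C, is_zero Z;
  abelian_biproduct : forall X Y : C, exists B (i1 : hom X B) (i2 : hom Y B)
    (p1 : hom B X) (p2 : hom B Y), is_biproduct i1 i2 p1 p2;
  abelian_kernel : forall (X Y : C) (f : hom X Y),
    exists K (k : hom K X), is_kernel f k;
  abelian_cokernel : forall (X Y : C) (f : hom X Y),
    exists Q (q : hom Y Q), is_cokernel f q;
  abelian_mono : forall (X Y : C) (f : hom X Y), mono f ->
    exists Z (g : hom Y Z), is_kernel g f;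
  abelian_epi : forall (X Y : C) (f : hom X Y), epi f ->
    exists Z (g : hom Z X), is_cokernel g f }.

Record abelian := Abelian {
  abelian_cat :> preadditive;
  abelianP : is_abelian abelian_cat }.

Definition artinian (A : abelian) : Prop := forall X : A, finite_length X.

(** * Functors and natural isomorphisms *)

Record functor (C D : preadditive) := Functor {
  fobj :> C -> D;
  fmap : forall X Y, hom X Y -> hom (fobj X) (fobj Y);
  fmap1 : forall X, fmap (idm X) = idm (fobj X);
  fmapM : forall X Y Z (g : hom Y Z) (f : hom X Y),
    fmap (g ∘ f) = fmap g ∘ fmap f }.

Arguments fmap {C D} _ {X Y} _.

Definition functor_id (C : preadditive) : functor C C :=
  @Functor C C id (fun X Y f => f) (fun=> erefl) (fun _ _ _ _ _ => erefl).

Section Composition.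
Variables (C D E : preadditive) (G : functor D E) (F : functor C D).

Definition comp_fmap X Y (f : hom X Y) : hom (G (F X)) (G (F Y)) :=
  fmap G (fmap F f).

Fact comp_fmap1 X : comp_fmap (idm X) = idm (G (F X)).
Proof. by rewrite /comp_fmap !fmap1. Qed.

Fact comp_fmapM X Y Z (g : hom Y Z) (f : hom X Y) :
  comp_fmap (g ∘ f) = comp_fmap g ∘ comp_fmap f.
Proof. by rewrite /comp_fmap !fmapM. Qed.

Definition functor_comp : functor C E := Functor comp_fmap1 comp_fmapM.

End Composition.

Notation "G ∘F F" := (functor_comp G F) (at level 40, left associativity).

Definition additive_functor (C D : preadditive) (F : functor C D) : Prop :=
  forall (X Y : C) (f g : hom X Y), fmap F (f + g) = fmap F f + fmap F g.

Definition exact_functor (C D : preadditive) (F : functor C D) : Prop :=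
  additive_functor F /\
  forall (X Y Z : C) (f : hom X Y) (g : hom Y Z),
    short_exact f g -> short_exact (fmap F f) (fmap F g).

Record natiso (C D : preadditive) (F G : functor C D) := NatIso {
  nat_fwd :> forall X, hom (F X) (G X);
  nat_bwd : forall X, hom (G X) (F X);
  nat_fwdK : forall X, nat_bwd X ∘ nat_fwd X = idm (F X);
  nat_bwdK : forall X, nat_fwd X ∘ nat_bwd X = idm (G X);
  naturality : forall X Y (f : hom X Y),
    nat_fwd Y ∘ fmap F f = fmap G f ∘ nat_fwd X }.

(* Strict automorphism: the composites with the inverse are equal, not merely
   isomorphic, to the identity functor. *)
Record automorphism (C : preadditive) := Automorphism {
  aut :> functor C C;
  aut_inv : functor C C;
  aut_invK : aut ∘F aut_inv = functor_id C;
  autK : aut_inv ∘F aut = functor_id C }.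

(** * Graded covers *)

Section Shifts.
Variables (C A : preadditive) (T : automorphism C).
Variables (v : functor C A) (eps : natiso v (v ∘F T)).

Definition shift (i : int) : functor C C :=
  match i with
  | Posz n => iter n (functor_comp T) (functor_id C)
  | Negz n => iter n.+1 (functor_comp (aut_inv T)) (functor_id C)
  end.

Lemma aut_invK_obj (N : C) : T (aut_inv T N) = N.
Proof. exact: (congr1 (fun F : functor C C => F N) (aut_invK T)). Qed.

Fixpoint unshift_pos (n : nat) (N : C) :
    hom (v (iter n (functor_comp T) (functor_id C) N)) (v N) :=
  match n with
  | 0 => idm (v N)
  | m.+1 => unshift_pos m N ∘ nat_bwd eps _
  end.

(* With Y = N[-m], the successor step is
   v(Y[-1]) -> v(Y[-1][1]) = v(Y) -> v(N). *)
Fixpoint unshift_neg (n : nat) (N : C) :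
    hom (v (iter n (functor_comp (aut_inv T)) (functor_id C) N)) (v N) :=
  match n with
  | 0 => idm (v N)
  | m.+1 =>
      unshift_neg m N ∘ fmap v (eq_hom (aut_invK_obj _)) ∘ nat_fwd eps _
  end.

(* The identification v(N[i]) -> v(N). *)
Definition unshift (i : int) (N : C) : hom (v (shift i N)) (v N) :=
  match i with
  | Posz n => unshift_pos n N
  | Negz n => unshift_neg n.+1 N
  end.

Definition graded_hom (M N : C) : Type :=
  {f : forall i : int, hom M (shift i N) | finite_set [set i | f i <> 0]}.

(* The \sum over setT runs over the indices with nonzero summand, of which
   there are finitely many as soon as v is additive. *)
Definition degrade (M N : C) (f : graded_hom M N) : hom (v M) (v N) :=
  \sum_(i \in [set: int]) (unshift i N ∘ fmap v (sval f i)).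

End Shifts.

(* In gc_hom, degrade is additive since gc_v is, so that bijectivity amounts to
   being an isomorphism of abelian groups. *)
Record graded_cover (A : abelian) := GradedCover {
  gc_cat :> abelian;
  gc_shift : automorphism gc_cat;
  gc_v : functor gc_cat A;
  gc_exact : exact_functor gc_v;
  gc_eps : natiso gc_v (gc_v ∘F gc_shift);
  gc_hom : forall M N : gc_cat, bijective (@degrade _ _ _ _ gc_eps M N);
  gc_epi : forall (M : A) (N : gc_cat) (p : hom M (gc_v N)), epi p ->
    exists (P : gc_cat) (q : hom (gc_v P) M), epi q /\
    exists r : hom P N, p ∘ q = fmap gc_v r }.

Arguments gc_shift {A} g.
Arguments gc_v {A} g.
Arguments gc_eps {A} g.

Record cover_equivalence (A : abelian) (G H : graded_cover A) :=
CoverEquivalence {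
  ce_functor : functor G H;
  ce_additive : additive_functor ce_functor;
  ce_pi : natiso (gc_v H ∘F ce_functor) (gc_v G);
  ce_eps : natiso (gc_shift H ∘F ce_functor) (ce_functor ∘F gc_shift G);
  ce_coherence : forall X : G,
    ce_pi (gc_shift G X) ∘ (fmap (gc_v H) (ce_eps X) ∘ gc_eps H (ce_functor X))
    = gc_eps G X ∘ ce_pi X }.

Definition cover_equivalent (A : abelian) (G H : graded_cover A) : Prop :=
  inhabited (cover_equivalence G H).

(* Main.v *)
From mathcomp Require Import all_boot all_algebra finmap.
From mathcomp Require Import boolp classical_sets cardinality fsbigop.
Require Import Defs.

Set Implicit Arguments.
Unset Strict Implicit.
Unset Printing Implicit Defensive.

(** Reflexivity and transitivity hold because identities and composites of
    cover-equivalences are cover-equivalences.  For symmetry, the functor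
    F : G -> H of a cover-equivalence is shown to be an equivalence of
    categories; a quasi-inverse then inherits pi and epsilon by transport.

    Write v for either degrading functor.  The degree 0 part of the isomorphism
    between graded and ungraded morphisms makes v faithful ([gc_faithful]), and
    F is faithful since v F is isomorphic to v ([ce_faithful]).

    F is full ([ce_full]).  A morphism h : F M -> F N gives a morphism
    v M -> v N, that is, a family f_i : M -> N[i].  Applying F, and identifying
    F(N[i]) with (F N)[i] compatibly with the degrading functors ([ce_shift]),
    gives a family F M -> (F N)[i] with the same image v h as the family
    concentrated in degree 0 with value h.  The two families are therefore
    equal, and h = F f_0.

    F is essentially surjective ([ce_essentially_surjective]).  For Y in H, the
    lifting property of G at the zero object gives P in G and an epimorphism
    v P -> v Y.  Its homogeneous components F P -> Y[i] can be shifted back to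
    morphisms F P_i -> Y ([ce_lift]), which are jointly epimorphic because v is
    faithful.  Hence every object of H is a quotient of some F P
    ([ce_generate]).  Using this for Y and then for the kernel of F P -> Y, and
    using fullness, one writes Y as the cokernel of F g for some g : R -> P;
    since v F is exact and v is faithful, Y is isomorphic to F (coker g). *)

Import GRing.Theory.
Local Open Scope ring_scope.
Local Open Scope classical_set_scope.

(** * Preadditive categories and functors *)

Section Preadditive.
Variable C : preadditive.
Implicit Types X Y Z W : C.

Lemma compm0 X Y Z (g : hom Y Z) : g ∘ (0 : hom X Y) = 0.
Proof. by apply: (addrI (g ∘ 0)); rewrite -compDr !addr0. Qed.

Lemma comp0m X Y Z (f : hom X Y) : (0 : hom Y Z) ∘ f = 0.
Proof. by apply: (addrI (0 ∘ f)); rewrite -compDl !addr0. Qed.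

Lemma compBl X Y Z (g g' : hom Y Z) (f : hom X Y) :
  (g - g') ∘ f = g ∘ f - g' ∘ f.
Proof. by apply: (addIr (g' ∘ f)); rewrite -compDl !subrK. Qed.

Lemma comp_suml (I : Type) (r : seq I) X Y Z (g : I -> hom Y Z) (f : hom X Y) :
  (\sum_(i <- r) g i) ∘ f = \sum_(i <- r) (g i ∘ f).
Proof.
by apply: (big_morph (fun h => h ∘ f)) => [g1 g2|]; rewrite ?compDl ?comp0m.
Qed.

Lemma comp_sumr (I : Type) (r : seq I) X Y Z (g : hom Y Z) (f : I -> hom X Y) :
  g ∘ (\sum_(i <- r) f i) = \sum_(i <- r) (g ∘ f i).
Proof.
by apply: (big_morph (comp g)) => [f1 f2|]; rewrite ?compDr ?compm0.
Qed.

Lemma epi_from0 X Y (f : hom X Y) :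
  (forall W (t : hom Y W), t ∘ f = 0 -> t = 0) -> epi f.
Proof.
move=> f0 W g h gfhf; apply/eqP; rewrite -subr_eq0; apply/eqP; apply: f0.
by rewrite compBl gfhf subrr.
Qed.

Lemma epi_comp X Y Z (g : hom Y Z) (f : hom X Y) : epi g -> epi f -> epi (g ∘ f).
Proof. by move=> eg ef W s t; rewrite !compA => /ef/eg. Qed.

Lemma epi_compr X Y Z (g : hom Y Z) (f : hom X Y) : epi (g ∘ f) -> epi g.
Proof. by move=> egf W s t st; apply: egf; rewrite !compA st. Qed.

Lemma mono_compl X Y Z (g : hom Y Z) (f : hom X Y) : mono (g ∘ f) -> mono f.
Proof. by move=> mgf W s t st; apply: mgf; rewrite -!compA st. Qed.

Lemma mono_id X : mono (idm X).
Proof. by move=> W s t; rewrite !comp1m. Qed.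

Lemma epi_id X : epi (idm X).
Proof. by move=> W s t; rewrite !compm1. Qed.

Lemma comp_linv X Y Z (f : hom X Y) (f' : hom Y X) (g : hom Y Z) (g' : hom Z Y) :
  f' ∘ f = idm X -> g' ∘ g = idm Y -> f' ∘ g' ∘ (g ∘ f) = idm X.
Proof. by move=> f'f g'g; rewrite -compA (compA g') g'g comp1m. Qed.

Lemma kernel_mono X Y (f : hom X Y) K (k : hom K X) : is_kernel f k -> mono k.
Proof.
move=> [fk0 univ] W g h kgkh.
have [|u [_ uniq_u]] := univ W (k ∘ h); first by rewrite compA fk0 comp0m.
by rewrite -(uniq_u g) // -(uniq_u h).
Qed.

Lemma cokernel_epi X Y (f : hom X Y) Q (q : hom Y Q) : is_cokernel f q -> epi q.
Proof.
move=> [qf0 univ] W g h gqhq.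
have [|u [_ uniq_u]] := univ W (h ∘ q); first by rewrite -compA qf0 compm0.
by rewrite -(uniq_u g) // -(uniq_u h).
Qed.

(** Composites of equality morphisms are determined by their end points,
    because any two proofs of an equality agree. *)
Lemma eq_hom_loop X (e : X = X) : eq_hom e = idm X.
Proof. by rewrite (Prop_irrelevance e erefl). Qed.

Lemma eq_homK X Y (e : X = Y) (e' : Y = X) : eq_hom e' ∘ eq_hom e = idm X.
Proof. by case: Y / e e' => e'; rewrite eq_hom_loop comp1m. Qed.

End Preadditive.

Lemma fmap_eq_hom (C D : preadditive) (F : functor C D) (X Y : C) (e : X = Y) :
  fmap F (eq_hom e) = eq_hom (congr1 F e).
Proof. by case: Y / e; rewrite fmap1. Qed.

Lemma fmap_linv (C D : preadditive) (F : functor C D) (X Y : C)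
    (f : hom X Y) (g : hom Y X) :
  g ∘ f = idm X -> fmap F g ∘ fmap F f = idm (F X).
Proof. by move=> gf; rewrite -fmapM gf fmap1. Qed.

Lemma eq_functor_obj (C D : preadditive) (F G : functor C D) :
  F = G -> forall X, F X = G X.
Proof. by move=> ->. Qed.

Lemma eq_functor_natural (C D : preadditive) (F G : functor C D) (FG : F = G)
    (X Y : C) (f : hom X Y) (eX : F X = G X) (eY : F Y = G Y) :
  eq_hom eY ∘ fmap F f = fmap G f ∘ eq_hom eX.
Proof. by case: G / FG eX eY => eX eY; rewrite !eq_hom_loop compm1 comp1m. Qed.

Lemma fmap0 (C D : preadditive) (F : functor C D) (X Y : C) :
  additive_functor F -> fmap F (0 : hom X Y) = 0.
Proof. by move=> addF; apply: (addrI (fmap F 0)); rewrite -addF !addr0. Qed.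

Section Automorphism.
Variables (C : preadditive) (T : automorphism C).

(** A preimage of f : T X -> T Y is its image under the strict inverse of T,
    conjugated by equality morphisms. *)
Lemma automorphism_full (X Y : C) (f : hom (T X) (T Y)) :
  exists g : hom X Y, fmap T g = f.
Proof.
have eK Z : aut_inv T (T Z) = Z := eq_functor_obj (autK T) Z.
exists (eq_hom (eK Y) ∘ fmap (aut_inv T) f ∘ eq_hom (esym (eK X))).
rewrite !fmapM !fmap_eq_hom.
have natf := eq_functor_natural (aut_invK T) f
  (aut_invK_obj T (T X)) (aut_invK_obj T (T Y)).
rewrite /= /comp_fmap in natf.
rewrite (Prop_irrelevance (congr1 T (eK Y)) (aut_invK_obj T (T Y))).
by rewrite natf -compA eq_homK compm1.
Qed.

Lemma aut_invK_natural (X Y : C) (f : hom X Y) :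
  eq_hom (aut_invK_obj T Y) ∘ fmap T (fmap (aut_inv T) f)
  = f ∘ eq_hom (aut_invK_obj T X).
Proof. exact: (eq_functor_natural (aut_invK T)). Qed.

End Automorphism.

Section Faithful.
Variables (C D : preadditive) (F : functor C D).

Definition faithful : Prop :=
  forall X Y (f g : hom X Y), fmap F f = fmap F g -> f = g.

Hypothesis F_faithful : faithful.

Lemma faithful_mono X Y (f : hom X Y) : mono (fmap F f) -> mono f.
Proof.
by move=> mf W g h fgfh; apply/F_faithful/mf; rewrite -!fmapM fgfh.
Qed.

Lemma faithful_epi X Y (f : hom X Y) : epi (fmap F f) -> epi f.
Proof.
by move=> ef W g h gfhf; apply/F_faithful/ef; rewrite -!fmapM gfhf.
Qed.

End Faithful.

(** * Abelian categories *)

Section Abelian.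
Variable A : abelian.
Implicit Types X Y : A.

(** In an abelian category an epimorphism is the cokernel of something, hence
    of its kernel. *)
Lemma epi_short_exact X Y K (q : hom X Y) (k : hom K X) :
  epi q -> is_kernel q k -> short_exact k q.
Proof.
move=> eq ker; split=> //; split; first by case: ker.
have [Z [g [qg0 univ]]] := abelian_epi (abelianP A) eq.
move=> W w wk0; apply: univ.
have [h [<- _]] := ker.2 _ _ qg0.
by rewrite compA wk0 comp0m.
Qed.

Lemma mono_epi_iso X Y (f : hom X Y) : mono f -> epi f -> is_iso f.
Proof.
move=> mf ef; have [K [k [fk0 univ]]] := abelian_epi (abelianP A) ef.
(* k 0 was chosen, but compatibility with pi and faithfulness determine it. *)
have k0 : k = 0 by apply: mf; rewrite fk0 compm0.
have [|g [gf _]] := univ _ (idm X); first by rewrite k0 compm0.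
exists g; split=> //; apply: ef; by rewrite -compA gf comp1m compm1.
Qed.

(** If t kills e and k is the kernel of t, then the mono m k is the kernel of
    a map that kills g, hence factors through q and kills m; so m factors
    through m k, and t = 0. *)
Lemma image_factorization X Y Q I (g : hom X Y) (q : hom Y Q) (m : hom I Y) :
  is_cokernel g q -> is_kernel q m -> exists2 e : hom X I, epi e & m ∘ e = g.
Proof.
move=> coker ker; have [e [me _]] := ker.2 _ _ coker.1.
exists e => //; apply: epi_from0 => W t te0.
have [K [k kerk]] := abelian_kernel (abelianP A) t.
have [e' [ke' _]] := kerk.2 _ _ te0.
have mmk : mono (m ∘ k).
  move=> V s s'; rewrite -!compA => /(kernel_mono ker).
  exact: (kernel_mono kerk).
have [Z [c [cmk0 univ]]] := abelian_mono (abelianP A) mmk.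
have [|s [sq _]] := coker.2 _ c.
  by rewrite -me -ke' !compA -(compA c) cmk0 comp0m.
have [|w [mkw _]] := univ _ m; first by rewrite -sq -compA ker.1 compm0.
have kw1 : k ∘ w = idm I.
  by apply: (kernel_mono ker); rewrite compA mkw compm1.
by rewrite -(compm1 t) -kw1 compA kerk.1 comp0m.
Qed.

End Abelian.

Lemma exact_epi (A B : abelian) (F : functor A B) (X Y : A) (q : hom X Y) :
  exact_functor F -> epi q -> epi (fmap F q).
Proof.
move=> [_ exF] eq; have [K [k ker]] := abelian_kernel (abelianP A) q.
by have [_] := exF _ _ _ _ _ (epi_short_exact eq ker); apply: cokernel_epi.
Qed.

(** * Natural isomorphisms *)

Section NatisoIso.
Variables (C D : preadditive) (F G : functor C D).

Variable a : natiso F G.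

Lemma natiso_epi X : epi (a X).
Proof.
by apply: (@epi_compr _ _ _ _ _ (nat_bwd a X)); rewrite nat_bwdK; apply: epi_id.
Qed.

Lemma natiso_mono X : mono (a X).
Proof.
by apply: (@mono_compl _ _ _ _ (nat_bwd a X)); rewrite nat_fwdK; apply: mono_id.
Qed.

Lemma natiso_bwd_epi X : epi (nat_bwd a X).
Proof.
by apply: (@epi_compr _ _ _ _ _ (a X)); rewrite nat_fwdK; apply: epi_id.
Qed.

Lemma bwd_naturality X Y (f : hom X Y) :
  nat_bwd a Y ∘ fmap G f = fmap F f ∘ nat_bwd a X.
Proof.
rewrite -[fmap G f]compm1 -(nat_bwdK a X) [fmap G f ∘ _]compA -naturality.
by rewrite !compA nat_fwdK comp1m.
Qed.

End NatisoIso.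

Arguments natiso_epi {C D F G} a X _ _ _ _.
Arguments natiso_mono {C D F G} a X _ _ _ _.
Arguments natiso_bwd_epi {C D F G} a X _ _ _ _.

(** * Degrees *)

Section Degrade.
Variables (C A : preadditive) (T : automorphism C).
Variables (v : functor C A) (eps : natiso v (v ∘F T)).
Hypothesis addv : additive_functor v.

(** Summing over any finite set that contains the support makes degrade
    accessible to the usual lemmas on finite sums. *)
Lemma degradeE (M N : C) (f : graded_hom T M N) (S : {fset int}) :
  (forall i, i \notin S -> sval f i = 0) ->
  degrade eps f = \sum_(i <- S) (unshift eps i N ∘ fmap v (sval f i)).
Proof.
move=> f0; apply: fsbigTE => i /f0 ->; by rewrite (fmap0 _ _ addv) compm0.
Qed.

Definition degree0_fun (M N : C) (h : hom M N) (i : int) : hom M (shift T i N) :=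
  match i return hom M (shift T i N) with Posz 0 => h | _ => 0 end.

Lemma degree0_finite (M N : C) (h : hom M N) :
  finite_set [set i | degree0_fun h i <> 0].
Proof.
apply: (@sub_finite_set _ _ [set (0 : int)]); last exact: finite_set1.
by move=> [[|n]|n].
Qed.

Definition degree0 (M N : C) (h : hom M N) : graded_hom T M N :=
  exist _ (degree0_fun h) (degree0_finite h).

Lemma degrade0 (M N : C) (h : hom M N) : degrade eps (degree0 h) = fmap v h.
Proof.
rewrite (@degradeE _ _ _ [fset 0%R]%fset).
  by rewrite big_seq_fset1 /= comp1m.
by move=> [[|n]|n] //; rewrite inE.
Qed.

End Degrade.

(** Nonnegative and negative degrees are the iterates of one step S, namely [1]
    or [-1], together with an identification v S -> v.  Statements on all
    degrees are proved once for such a pair. *)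
Section IteratedUnshift.
Variables (C A : preadditive) (v : functor C A) (S : functor C C).
Variable sg : forall X, hom (v (S X)) (v X).

Fixpoint iter_unshift (n : nat) (N : C) :
    hom (v (iter n (functor_comp S) (functor_id C) N)) (v N) :=
  match n with
  | 0 => idm (v N)
  | m.+1 => iter_unshift m N ∘ sg _
  end.

End IteratedUnshift.

Section UnshiftSteps.
Variables (C A : preadditive) (T : automorphism C).
Variables (v : functor C A) (eps : natiso v (v ∘F T)).

(** The identification v(X[-1]) -> v(X). *)
Definition unshift_inv (X : C) : hom (v (aut_inv T X)) (v X) :=
  fmap v (eq_hom (aut_invK_obj T X)) ∘ eps (aut_inv T X).

Lemma unshift_posE n N :
  unshift eps (Posz n) N = iter_unshift (nat_bwd eps) n N.
Proof. by rewrite /=; elim: n => //= n ->. Qed.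

Lemma unshift_negE n N :
  unshift eps (Negz n) N = iter_unshift unshift_inv n.+1 N.
Proof.
have E m : unshift_neg eps m N = iter_unshift unshift_inv m N.
  by elim: m => //= m ->; rewrite /unshift_inv compA.
exact: E.
Qed.

Lemma unshift_inv_natural (X Y : C) (f : hom X Y) :
  unshift_inv Y ∘ fmap v (fmap (aut_inv T) f) = fmap v f ∘ unshift_inv X.
Proof.
rewrite /unshift_inv -compA (naturality eps) /= /comp_fmap !compA -!fmapM.
by rewrite aut_invK_natural.
Qed.

End UnshiftSteps.

(** * The functor of a cover-equivalence *)

Section GradedCover.
Variables (A : abelian) (G : graded_cover A).

Lemma gc_additive : additive_functor (gc_v G).
Proof. by case: (gc_exact G). Qed.

Lemma gc_faithful : faithful (gc_v G).
Proof.
move=> X Y f g fg.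
have : degree0 (gc_shift G) f = degree0 (gc_shift G) g.
  by apply: (bij_inj (gc_hom X Y)); rewrite !(degrade0 _ gc_additive).
by move=> /(congr1 (fun h => sval h (Posz 0))).
Qed.

(** The lifting property for the epimorphism from Y to the zero object v 0. *)
Lemma gc_generate (Y : A) : exists (P : G) (q : hom (gc_v G P) Y), epi q.
Proof.
have [Z Z0] := abelian_zero (abelianP G).
have idZ : idm Z = 0.
  by have [[h [_ uniq_h]] _] := Z0 Z; rewrite -(uniq_h (idm Z)) // (uniq_h 0).
have epi0 : epi (0 : hom Y (gc_v G Z)).
  move=> W g h _; rewrite -(compm1 g) -(compm1 h) -fmap1 idZ.
  by rewrite (fmap0 _ _ gc_additive) !compm0.
by have [P [q [eq _]]] := gc_epi epi0; exists P, q.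
Qed.

End GradedCover.

Arguments gc_faithful {A} G X Y f g _.
Arguments gc_generate {A} G Y.

Section Equivalence.
Variables (A : abelian) (G H : graded_cover A) (E : cover_equivalence G H).

Local Notation F := (ce_functor E).
Local Notation vG := (gc_v G).
Local Notation vH := (gc_v H).
Local Notation TG := (gc_shift G).
Local Notation TH := (gc_shift H).
Local Notation pi := (ce_pi E).
Local Notation eps := (ce_eps E).

Lemma pi_natural (X Y : G) (f : hom X Y) :
  pi Y ∘ fmap vH (fmap F f) = fmap vG f ∘ pi X.
Proof. exact: (naturality pi). Qed.

Lemma pi_bwd_natural (X Y : G) (f : hom X Y) :
  nat_bwd pi Y ∘ fmap vG f = fmap vH (fmap F f) ∘ nat_bwd pi X.
Proof. exact: (bwd_naturality pi). Qed.

Lemma ce_faithful : faithful F.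
Proof.
move=> X Y f g fg; apply: (gc_faithful G).
by apply: (natiso_epi pi _); rewrite -!pi_natural fg.
Qed.

Lemma ce_preserve_epi (X Y : G) (f : hom X Y) : epi f -> epi (fmap F f).
Proof.
move=> /(exact_epi (gc_exact G)) evf; apply: (faithful_epi (gc_faithful H)).
apply: (@epi_compr _ _ _ _ _ (nat_bwd pi X)).
rewrite -pi_bwd_natural; apply: epi_comp => //.
exact: natiso_bwd_epi pi Y.
Qed.

(** SG and SH stand for [1] on G and H, or for [-1] on G and H. *)
Section Step.
Variables (SG : functor G G) (SH : functor H H).
Variables (sgG : forall X, hom (vG (SG X)) (vG X)).
Variables (sgH : forall X, hom (vH (SH X)) (vH X)).

Hypothesis sgH_natural : forall (X Y : H) (f : hom X Y),
  sgH Y ∘ fmap vH (fmap SH f) = fmap vH f ∘ sgH X.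

Hypothesis step_shift : forall X : G, exists k : hom (F (SG X)) (SH (F X)),
  pi X ∘ sgH (F X) ∘ fmap vH k = sgG X ∘ pi (SG X).

Lemma iter_shift (n : nat) (N : G) :
  let NG := iter n (functor_comp SG) (functor_id G) N in
  let NH := iter n (functor_comp SH) (functor_id H) (F N) in
  exists k : hom (F NG) NH,
    pi N ∘ iter_unshift sgH n (F N) ∘ fmap vH k = iter_unshift sgG n N ∘ pi NG.
Proof.
elim: n => [|n [k IH]] /=; first by exists (idm _); rewrite fmap1 !compm1 comp1m.
have [l lP] := step_shift (iter n (functor_comp SG) (functor_id G) N).
exists (fmap SH k ∘ l); rewrite fmapM -!compA (compA _ _ (fmap vH l)) sgH_natural.
by rewrite -compA -lP !compA IH.
Qed.

Hypothesis step_lift : forall (M : G) (N : H) (f : hom (F M) (SH N)),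
  exists (M' : G) (f' : hom (F M') N) (a : hom (vH (F M)) (vH (F M'))),
    sgH N ∘ fmap vH f = fmap vH f' ∘ a.

Lemma iter_lift (n : nat) (M : G) (N : H)
    (f : hom (F M) (iter n (functor_comp SH) (functor_id H) N)) :
  exists (M' : G) (f' : hom (F M') N) (a : hom (vH (F M)) (vH (F M'))),
    iter_unshift sgH n N ∘ fmap vH f = fmap vH f' ∘ a.
Proof.
elim: n M f => [|n IH] M f /=.
  by exists M, f, (idm _); rewrite comp1m compm1.
have [M1 [f1 [a1 fa1]]] := step_lift f.
have [M2 [f2 [a2 fa2]]] := IH M1 f1.
by exists M2, f2, (a2 ∘ a1); rewrite [RHS]compA -fa2 -!compA fa1.
Qed.

End Step.

(** The coherence axiom with every isomorphism in it inverted, except pi. *)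
Lemma pos_step_shift (X : G) : exists k : hom (F (TG X)) (TH (F X)),
  pi X ∘ nat_bwd (gc_eps H) (F X) ∘ fmap vH k
  = nat_bwd (gc_eps G) X ∘ pi (TG X).
Proof.
exists (nat_bwd eps X).
have epsK : fmap vH (eps X) ∘ gc_eps H (F X)
    ∘ (nat_bwd (gc_eps H) (F X) ∘ fmap vH (nat_bwd eps X)) = idm _.
  apply: comp_linv; last exact: (nat_bwdK (gc_eps H)).
  exact: (fmap_linv _ (nat_bwdK eps X)).
apply: (natiso_mono (gc_eps G) _); rewrite [RHS]compA nat_bwdK comp1m.
by rewrite -!compA compA -ce_coherence -compA epsK compm1.
Qed.

(** As [1] is full on H, it suffices to give k[1] : F(X[-1])[1] -> F(X)[-1][1].
    Both ends are isomorphic to F X, the first by epsilon. *)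
Lemma neg_step_shift (X : G) :
  exists k : hom (F (aut_inv TG X)) (aut_inv TH (F X)),
  pi X ∘ unshift_inv (gc_eps H) (F X) ∘ fmap vH k
  = unshift_inv (gc_eps G) X ∘ pi (aut_inv TG X).
Proof.
set X' := aut_inv TG X.
have [k Tk] := automorphism_full (eq_hom (esym (aut_invK_obj TH (F X)))
  ∘ fmap F (eq_hom (aut_invK_obj TG X)) ∘ eps X').
exists k; rewrite /unshift_inv -!compA (naturality (gc_eps H)) /= /comp_fmap Tk.
rewrite [fmap vH (eq_hom _) ∘ _]compA -fmapM !compA eq_homK comp1m fmapM.
rewrite (compA (pi X)) pi_natural -!compA; congr (_ ∘ _).
exact: ce_coherence.
Qed.

(** M' = M[-1]: since F M is isomorphic to F(M')[1], the morphism f is the shift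
    of some f', by fullness of [1]. *)
Lemma pos_step_lift (M : G) (N : H) (f : hom (F M) (TH N)) :
  exists (M' : G) (f' : hom (F M') N) (a : hom (vH (F M)) (vH (F M'))),
    nat_bwd (gc_eps H) N ∘ fmap vH f = fmap vH f' ∘ a.
Proof.
set M' := aut_inv TG M; have eM : TG M' = M := aut_invK_obj TG M.
have [f' Tf'] := automorphism_full (f ∘ fmap F (eq_hom eM) ∘ eps M').
exists M', f', (nat_bwd (gc_eps H) (F M') ∘
  fmap vH (nat_bwd eps M' ∘ fmap F (eq_hom (esym eM)))).
rewrite compA -(bwd_naturality (gc_eps H)) /= /comp_fmap Tf' -compA -fmapM.
congr (_ ∘ fmap vH _).
rewrite -!compA (compA (eps M')) (nat_bwdK eps) comp1m -fmapM eq_homK fmap1.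
by rewrite compm1.
Qed.

(** M' = M[1], with f' the shift of f up to F(M[1]) = F(M)[1] and N[-1][1] = N. *)
Lemma neg_step_lift (M : G) (N : H) (f : hom (F M) (aut_inv TH N)) :
  exists (M' : G) (f' : hom (F M') N) (a : hom (vH (F M)) (vH (F M'))),
    unshift_inv (gc_eps H) N ∘ fmap vH f = fmap vH f' ∘ a.
Proof.
exists (TG M), (eq_hom (aut_invK_obj TH N) ∘ fmap TH f ∘ nat_bwd eps M).
exists (fmap vH (eps M) ∘ gc_eps H (F M)).
rewrite /unshift_inv -compA (naturality (gc_eps H)) /= /comp_fmap !compA -!fmapM.
by rewrite -(compA _ _ (eps M)) nat_fwdK compm1.
Qed.

Lemma nat_bwd_natural (X Y : H) (f : hom X Y) :
  nat_bwd (gc_eps H) Y ∘ fmap vH (fmap TH f) = fmap vH f ∘ nat_bwd (gc_eps H) X.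
Proof. exact: (bwd_naturality (gc_eps H)). Qed.

Lemma ce_shift (i : int) (N : G) :
  exists k : hom (F (shift TG i N)) (shift TH i (F N)),
    pi N ∘ unshift (gc_eps H) i (F N) ∘ fmap vH k
    = unshift (gc_eps G) i N ∘ pi (shift TG i N).
Proof.
case: i => n; first rewrite !unshift_posE; last rewrite !unshift_negE.
  exact: (iter_shift nat_bwd_natural pos_step_shift).
exact: (iter_shift (unshift_inv_natural (gc_eps H)) neg_step_shift).
Qed.

Lemma ce_lift (i : int) (M : G) (N : H) (f : hom (F M) (shift TH i N)) :
  exists (M' : G) (f' : hom (F M') N) (a : hom (vH (F M)) (vH (F M'))),
    unshift (gc_eps H) i N ∘ fmap vH f = fmap vH f' ∘ a.
Proof.
case: i f => n f; first rewrite unshift_posE; last rewrite unshift_negE.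
  exact: (iter_lift pos_step_lift).
exact: (iter_lift neg_step_lift).
Qed.

(** Fullness of F, by comparison of homogeneous components. *)
Lemma ce_full (M N : G) (h : hom (F M) (F N)) : exists f : hom M N, fmap F f = h.
Proof.
have [dec _ decK] := gc_hom M N.
set f := dec (pi N ∘ fmap vH h ∘ nat_bwd pi M).
have fE : degrade (gc_eps G) f = pi N ∘ fmap vH h ∘ nat_bwd pi M by exact: decK.
(* k i is the identification of F(N[i]) with (F N)[i]. *)
pose k i := sval (cid (ce_shift i N)).
have kP i : pi N ∘ unshift (gc_eps H) i (F N) ∘ fmap vH (k i)
    = unshift (gc_eps G) i N ∘ pi (shift TG i N).
  by rewrite /k; case: cid.
pose gfun i : hom (F M) (shift TH i (F N)) := k i ∘ fmap F (sval f i).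
have gfun0 i : sval f i = 0 -> gfun i = 0.
  by rewrite /gfun => ->; rewrite (fmap0 _ _ (@ce_additive _ _ _ E)) compm0.
have gfin : finite_set [set i | gfun i <> 0].
  by apply: sub_finite_set (svalP f) => i /= gi0 fi0; apply/gi0/gfun0.
pose g : graded_hom TH (F M) (F N) := exist _ gfun gfin.
have gh : g = degree0 TH h.
  apply: (bij_inj (gc_hom (F M) (F N))); rewrite (degrade0 _ (@gc_additive _ H)).
  apply: (natiso_mono pi N).
  have /finite_fsetP[S SE] := svalP f.
  have f0 i : i \notin S -> sval f i = 0.
    by move=> iS; apply: contrapT => fi0; move/negP: iS; apply; move: fi0;
       rewrite -[_ <> _]/([set i | sval f i <> 0] i) SE.
  rewrite (@degradeE _ _ _ _ _ (@gc_additive _ H) _ _ g S) => [|i /f0 /gfun0 //].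
  rewrite comp_sumr (eq_bigr (fun i => unshift (gc_eps G) i N
    ∘ fmap vG (sval f i) ∘ pi M)) => [|i _]; last first.
    by rewrite fmapM -[RHS]compA -pi_natural !compA kP.
  rewrite -comp_suml -(degradeE _ (@gc_additive _ G)) // fE.
  by rewrite -compA nat_fwdK compm1.
have k0 : k (Posz 0) = idm (F N).
  apply: (gc_faithful H); apply: (natiso_mono pi N).
  by have := kP (Posz 0); rewrite /= compm1 comp1m fmap1 compm1.
exists (sval f (Posz 0)).
have := congr1 (fun g => sval g (Posz 0)) gh; rewrite /= /gfun k0.
by rewrite comp1m.
Qed.

(** Morphisms v(F P) -> v Y that factor through v f for some f : F M -> Y are
    closed under sums, as one sees by taking the direct sum of the objects M.
    By shifting, they include each homogeneous component of a morphism; hence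
    they include every morphism, and in particular an epimorphism. *)
Lemma ce_generate (Y : H) : exists (P : G) (p : hom (F P) Y), epi p.
Proof.
have [P [q eq]] := gc_generate G (vH Y).
pose covered (s : hom (vH (F P)) (vH Y)) :=
  exists (M : G) (f : hom (F M) Y) a, s = fmap vH f ∘ a.
have covered0 : covered 0.
  by exists P, 0, 0; rewrite compm0.
have coveredD s t : covered s -> covered t -> covered (s + t).
  move=> [M1 [f1 [a1 ->]]] [M2 [f2 [a2 ->]]].
  have [B [i1 [i2 [p1 [p2 [pi11 pi22 pi12 pi21 _]]]]]] :=
    abelian_biproduct (abelianP G) M1 M2.
  have addF := @ce_additive _ _ _ E.
  exists B, (f1 ∘ fmap F p1 + f2 ∘ fmap F p2).
  exists (fmap vH (fmap F i1) ∘ a1 + fmap vH (fmap F i2) ∘ a2).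
  rewrite compDr !compA -!fmapM !compDl -!compA -!fmapM pi11 pi22 pi12 pi21.
  by rewrite !(fmap0 _ _ addF) !fmap1 !compm0 !compm1 addr0 add0r.
have [dec _ decK] := gc_hom (F P) Y.
have : covered (q ∘ pi P).
  rewrite -(decK (q ∘ pi P)); apply: big_ind => // i _.
  by have [M' [f' [a ->]]] := ce_lift (sval (dec (q ∘ pi P)) i); exists M', f', a.
move=> [M [f [a qE]]]; exists M, f.
apply: (faithful_epi (gc_faithful H)); apply: (@epi_compr _ _ _ _ _ a).
by rewrite -qE; apply: epi_comp => //; apply: (natiso_epi pi P).
Qed.

(** With F R -> K the cover of the kernel k of p : F P -> Y, and q = coker g for
    the g : R -> P lifting F R -> K -> F P, the morphism F q kills k, which
    gives u : Y -> F Q with u p = F q.  It is an epimorphism as F q is.  The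
    cokernel property of v q yields w : v Q -> v Y that makes v u split mono. *)
Lemma ce_essentially_surjective (Y : H) :
  exists (X : G) (t : hom (F X) Y), is_iso t.
Proof.
have [P [p ep]] := ce_generate Y.
have [K [k kerk]] := abelian_kernel (abelianP H) p.
have [R [e ee]] := ce_generate K.
have [g Fg] := ce_full (k ∘ e).
have [Q [q cokq]] := abelian_cokernel (abelianP G) g.
have [I [m kerm]] := abelian_kernel (abelianP G) q.
have [e0 ee0 me0] := image_factorization cokq kerm.
have eq : epi q := cokernel_epi cokq.
have F0 := fmap0 _ _ (@ce_additive _ _ _ E).
have [u [up _]] : exists! u : hom Y (F Q), u ∘ p = fmap F q.
  apply: (epi_short_exact ep kerk).2.2; apply: ee.
  by rewrite -compA -Fg -fmapM cokq.1 F0 comp0m.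
(* The hypothesis on v concerns short exact sequences only, so the relation
   p (F g) = 0 is passed from g to its image m. *)
have pm0 : p ∘ fmap F m = 0.
  apply: (ce_preserve_epi ee0); rewrite -compA -fmapM me0 Fg compA kerk.1.
  by rewrite !comp0m.
have [_ cokvm] := (gc_exact G).2 _ _ _ _ _ (epi_short_exact eq kerm).
have [|w [wq _]] := cokvm.2 _ (fmap vH p ∘ nat_bwd pi P).
  by rewrite -compA pi_bwd_natural compA -fmapM pm0 (fmap0 _ _ (@gc_additive _ H)) comp0m.
have wu : w ∘ pi Q ∘ fmap vH u = idm (vH Y).
  have evp : epi (fmap vH p) by apply: exact_epi ep; apply: gc_exact.
  apply: evp; rewrite -!compA -fmapM up pi_natural compA wq -compA (nat_fwdK pi).
  by rewrite compm1 comp1m.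
have iu : is_iso u.
  apply: mono_epi_iso.
    apply: (faithful_mono (gc_faithful H)).
    by apply: (@mono_compl _ _ _ _ (w ∘ pi Q)); rewrite wu; apply: mono_id.
  by apply: (@epi_compr _ _ _ _ _ p); rewrite up; apply: ce_preserve_epi.
by have [t [tu ut]] := iu; exists Q, t; exists u.
Qed.

End Equivalence.

(** * Reflexivity and transitivity *)

Definition comp_functor_id (C D : preadditive) (F : functor C D) :
  natiso (F ∘F functor_id C) F.
Proof.
by apply: (@NatIso _ _ (F ∘F functor_id C) F
    (fun X => idm (F X)) (fun X => idm (F X))) => [X|X|X Y f];
  rewrite comp1m ?compm1.
Defined.

(** The two composites with the identity have the same values, but opaque proofs
    of functoriality keep them from being convertible. *)
Definition functor_id_central (C : preadditive) (F : functor C C) :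
  natiso (F ∘F functor_id C) (functor_id C ∘F F).
Proof.
by apply: (@NatIso _ _ (F ∘F functor_id C) (functor_id C ∘F F)
    (fun X => idm (F X)) (fun X => idm (F X))) => [X|X|X Y f];
  rewrite comp1m ?compm1.
Defined.

Definition cover_equivalence_id (A : abelian) (G : graded_cover A) :
  cover_equivalence G G.
Proof.
exists (functor_id G) (comp_functor_id (gc_v G))
  (functor_id_central (gc_shift G)) => // X.
by rewrite /= comp1m fmap1 comp1m compm1.
Defined.

Section Transitivity.
Variables (A : abelian) (G H K : graded_cover A).
Variables (E : cover_equivalence G H) (E' : cover_equivalence H K).

Local Notation F := (ce_functor E).
Local Notation F' := (ce_functor E').

Definition pi_comp : natiso (gc_v K ∘F (F' ∘F F)) (gc_v G).
Proof.
exists (fun X => ce_pi E X ∘ ce_pi E' (F X))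
  (fun X => nat_bwd (ce_pi E') (F X) ∘ nat_bwd (ce_pi E) X) => [X|X|X Y f].
- by apply: comp_linv; [apply: (nat_fwdK (ce_pi E'))|apply: (nat_fwdK (ce_pi E))].
- by apply: comp_linv; [apply: (nat_bwdK (ce_pi E))|apply: (nat_bwdK (ce_pi E'))].
- by rewrite -compA pi_natural compA pi_natural compA.
Defined.

Definition eps_comp :
  natiso (gc_shift K ∘F (F' ∘F F)) ((F' ∘F F) ∘F gc_shift G).
Proof.
exists (fun X => fmap F' (ce_eps E X) ∘ ce_eps E' (F X))
  (fun X => nat_bwd (ce_eps E') (F X) ∘ fmap F' (nat_bwd (ce_eps E) X))
  => [X|X|X Y f].
- apply: comp_linv; first exact: (nat_fwdK (ce_eps E')).
  exact: (fmap_linv _ (nat_fwdK (ce_eps E) X)).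
- apply: comp_linv; last exact: (nat_bwdK (ce_eps E')).
  exact: (fmap_linv _ (nat_bwdK (ce_eps E) X)).
- rewrite -compA (naturality (ce_eps E')) compA /= /comp_fmap -fmapM.
  by rewrite (naturality (ce_eps E)) fmapM compA.
Defined.

Definition cover_equivalence_comp : cover_equivalence G K.
Proof.
exists (F' ∘F F) pi_comp eps_comp => [X Y f g|X].
  by rewrite /= /comp_fmap !ce_additive.
rewrite /= fmapM.
have cE := ce_coherence E X; have cE' := ce_coherence E' (F X).
rewrite -!compA (compA (ce_pi E' (F (gc_shift G X)))) pi_natural -!compA.
by rewrite cE' (compA (fmap (gc_v H) _)) !compA -(compA (ce_pi E _)) cE.
Defined.

End Transitivity.

(** * Symmetry *)

Section Symmetry.
Variables (A : abelian) (G H : graded_cover A) (E : cover_equivalence G H).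

Local Notation F := (ce_functor E).
Local Notation pi := (ce_pi E).
Local Notation eps := (ce_eps E).

Definition full_preimage (M N : G) (h : hom (F M) (F N)) : hom M N :=
  sval (cid (ce_full h)).

Lemma full_preimageK (M N : G) (h : hom (F M) (F N)) : fmap F (full_preimage h) = h.
Proof. by rewrite /full_preimage; case: cid. Qed.

Lemma inverse_data : exists (S : H -> G) (t : forall Y, hom (F (S Y)) Y)
  (t' : forall Y, hom Y (F (S Y))),
  (forall Y, t' Y ∘ t Y = idm _) /\ (forall Y, t Y ∘ t' Y = idm Y).
Proof.
pose S Y := sval (cid (ce_essentially_surjective E Y)).
pose tP Y := svalP (cid (ce_essentially_surjective E Y)).
pose t Y := sval (cid (tP Y)).
pose t'P Y := svalP (cid (tP Y)).
pose t' Y := sval (cid (t'P Y)).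
by exists S, t, t'; split=> Y; have [] := svalP (cid (t'P Y)).
Qed.

Variables (S : H -> G) (t : forall Y, hom (F (S Y)) Y).
Variable t' : forall Y, hom Y (F (S Y)).
Hypothesis tK : forall Y, t' Y ∘ t Y = idm _.
Hypothesis t'K : forall Y, t Y ∘ t' Y = idm Y.

Definition inverse_fmap (X Y : H) (f : hom X Y) : hom (S X) (S Y) :=
  full_preimage (t' Y ∘ f ∘ t X).

Lemma inverse_fmap1 X : inverse_fmap (idm X) = idm (S X).
Proof.
by apply: (ce_faithful (E := E)); rewrite full_preimageK compm1 tK fmap1.
Qed.

Lemma inverse_fmapM X Y Z (g : hom Y Z) (f : hom X Y) :
  inverse_fmap (g ∘ f) = inverse_fmap g ∘ inverse_fmap f.
Proof.
apply: (ce_faithful (E := E)); rewrite fmapM !full_preimageK -!compA.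
by rewrite (compA (t Y)) t'K comp1m.
Qed.

Definition inverse_functor : functor H G := Functor inverse_fmap1 inverse_fmapM.

Lemma t_natural (X Y : H) (f : hom X Y) :
  t Y ∘ fmap F (fmap inverse_functor f) = f ∘ t X.
Proof. by rewrite full_preimageK !compA t'K comp1m. Qed.

Definition inverse_pi : natiso (gc_v G ∘F inverse_functor) (gc_v H).
Proof.
exists (fun Y => fmap (gc_v H) (t Y) ∘ nat_bwd pi (S Y))
  (fun Y => pi (S Y) ∘ fmap (gc_v H) (t' Y)) => [Y|Y|X Y f].
- by apply: comp_linv; [apply: (nat_bwdK pi)|apply: (fmap_linv _ (tK Y))].
- by apply: comp_linv; [apply: (fmap_linv _ (t'K Y))|apply: (nat_fwdK pi)].
- by rewrite -compA pi_bwd_natural compA -fmapM t_natural fmapM compA.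
Defined.

Definition inverse_eps_fwd (Y : H) :
    hom (gc_shift G (S Y)) (S (gc_shift H Y)) :=
  full_preimage (t' (gc_shift H Y) ∘ fmap (gc_shift H) (t Y) ∘ nat_bwd eps (S Y)).

Definition inverse_eps_bwd (Y : H) :
    hom (S (gc_shift H Y)) (gc_shift G (S Y)) :=
  full_preimage (eps (S Y) ∘ fmap (gc_shift H) (t' Y) ∘ t (gc_shift H Y)).

Definition inverse_eps :
  natiso (gc_shift G ∘F inverse_functor) (inverse_functor ∘F gc_shift H).
Proof.
exists inverse_eps_fwd inverse_eps_bwd => [Y|Y|X Y f];
  apply: (ce_faithful (E := E)); rewrite !fmapM ?fmap1 !full_preimageK.
- rewrite -(compA (t' _)); apply: comp_linv; last exact: t'K.
  by apply: comp_linv; [apply: (nat_bwdK eps)|apply: (fmap_linv _ (tK Y))].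
- rewrite -(compA (eps _)); apply: comp_linv; last exact: (nat_fwdK eps).
  apply: comp_linv; [exact: tK|exact: (fmap_linv _ (t'K Y))].
- rewrite /= /comp_fmap.
  have natE := bwd_naturality eps (fmap inverse_functor f).
  rewrite /= /comp_fmap in natE.
  rewrite -!compA natE (compA (fmap _ (t Y))) -fmapM t_natural fmapM.
  by rewrite (compA (t (gc_shift H X))) t'K comp1m !compA.
Defined.

Definition cover_equivalence_inv : cover_equivalence H G.
Proof.
exists inverse_functor inverse_pi inverse_eps => [X Y f g|Y].
  apply: (ce_faithful (E := E)).
  by rewrite ce_additive !full_preimageK compDr compDl.
(* After composition with pi (S Y), the coherence of E at S Y applies. *)
apply: (natiso_epi pi (S Y)).
rewrite /= -!compA (nat_fwdK pi) compm1.
rewrite -(ce_coherence E (S Y)).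
rewrite (compA (fmap (gc_v G) _)) -pi_natural full_preimageK.
rewrite -!compA (compA (nat_bwd pi _)) (nat_fwdK pi) comp1m.
rewrite (compA (fmap (gc_v H) _) (fmap (gc_v H) (eps _))) -fmapM.
rewrite -!compA (nat_fwdK eps) compm1 compA -fmapM compA t'K comp1m.
by rewrite (naturality (gc_eps H)).
Defined.

End Symmetry.

Theorem mainTheorem3 (A : abelian) (hA : artinian A) :
  (forall G : graded_cover A, cover_equivalent G G) /\
  (forall G H : graded_cover A, cover_equivalent G H -> cover_equivalent H G) /\
  (forall G H K : graded_cover A,
     cover_equivalent G H -> cover_equivalent H K -> cover_equivalent G K).
Proof.
split; [|split].
- by move=> G; constructor; apply: cover_equivalence_id.
- move=> G H [E]; have [S [t [t' [tK t'K]]]] := inverse_data E.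
  by constructor; apply: (cover_equivalence_inv tK t'K).
- by move=> G H K [E] [E']; constructor; apply: (cover_equivalence_comp E E').
Qed.
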